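(* For every $n\ge1$, the mappings $\Phi_C$ and $\Phi_{SZ}$ are bijections $\mathfrak{S}_n\to\mathfrak{S}_n$ such that for all $\sigma\in\mathfrak{S}_n$, $$(\mathrm{ndes},\mathrm{pmin},31\!-\!2,2\!-\!31,\mathrm{MADL},\mathrm{NDdif})\,\sigma=(\mathrm{wex},\mathrm{fix},\mathrm{nest},\mathrm{cros},\mathrm{inv},\mathrm{depth})\,\Phi_C(\sigma),$$ $$(\mathrm{ndes},\mathrm{fmax},31\!-\!2,2\!-\!31,\mathrm{MAD},\mathrm{NDdif})\,\sigma=(\mathrm{wex},\mathrm{fix},\mathrm{cros},\mathrm{nest},\mathrm{inv},\mathrm{depth})\,\Phi_{SZ}(\sigma).$$ Moreover, if $\Phi^*:=\Phi_{SZ}\circ\Phi_C^{-1}$, then for all $\sigma\in\mathfrak{S}_n$, $$(\mathrm{wex},\mathrm{nest},\mathrm{cros},\mathrm{depth})\,\sigma=(\mathrm{wex},\mathrm{cros},\mathrm{nest},\mathrm{depth})\,\Phi^*(\sigma).$$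
   Context: $\mathfrak{S}_n$ is the set of permutations $\sigma=\sigma_1\cdots\sigma_n$ of $[n]$, $\sigma_i=\sigma(i)$. For a tuple of statistics, $(\mathrm{st}_1,\mathrm{st}_2,\dots)\,\sigma$ means $(\mathrm{st}_1(\sigma),\mathrm{st}_2(\sigma),\dots)$. Word statistics. An index $i\in[n-1]$ is a descent if $\sigma_i>\sigma_{i+1}$; then $\sigma_i$ is a descent top and $\sigma_{i+1}$ a descent bottom. A letter is a nondescent top (resp. nondescent bottom) if it is not a descent top (resp. not a descent bottom). $\mathrm{des}(\sigma)$ is the number of descents, $\mathrm{ndes}(\sigma)=n-\mathrm{des}(\sigma)$, and $\mathrm{NDdif}(\sigma)$ is the sum of the nondescent bottoms minus the sum of the nondescent tops. $\mathrm{fmax}(\sigma)$ is the number of letters that are both a nondescent top and a left-to-right maximum (larger than all letters to their left); $\mathrm{pmin}(\sigma)$ is the number of letters that are both a nondescent bottom and a right-to-left minimum (smaller than all letters to their right). For $k=\sigma_j\in[n]$, set $(31\!-\!2)_k(\sigma)=\#\{i: i+1<j,\ \sigma_{i+1}<k<\sigma_i\}$ and $(2\!-\!31)_k(\sigma)=\#\{i: j<i-1,\ \sigma_i<k<\sigma_{i-1}\}$; $(31\!-\!2)(\sigma)=\sum_k(31\!-\!2)_k(\sigma)$, $(2\!-\!31)(\sigma)=\sum_k(2\!-\!31)_k(\sigma)$. Then $\mathrm{MAD}=\mathrm{des}+(31\!-\!2)+2\,(2\!-\!31)$ and $\mathrm{MADL}=\mathrm{des}+(2\!-\!31)+2\,(31\!-\!2)$.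 Cyclic statistics. $\mathrm{wex}(\tau)=\#\{i:\tau(i)\ge i\}$; $\mathrm{fix}(\tau)=\#\{i:\tau(i)=i\}$; $\mathrm{inv}(\tau)=\#\{i<j:\tau_i>\tau_j\}$; $\mathrm{depth}(\tau)=\sum_{\tau(i)>i}(\tau(i)-i)$; $\mathrm{cros}(\tau)=\#\{(i,j)\in[n]^2:(i<j\le\tau_i<\tau_j)\lor(i>j>\tau_i>\tau_j)\}$; $\mathrm{nest}(\tau)=\#\{(i,j)\in[n]^2:(i<j\le\tau_j<\tau_i)\lor(i>j>\tau_j>\tau_i)\}$. The maps. Given $\sigma\in\mathfrak{S}_n$, let $f_1<\cdots<f_m$ be its nondescent tops and $g_1<\cdots<g_r$ its descent tops in increasing order. Let $f'=f'_1\cdots f'_m$ be the unique arrangement of the nondescent bottoms of $\sigma$ such that $\#\{a<b: f'_a>f'_b\}=(31\!-\!2)_{f_b}(\sigma)$ for all $b$, and let $g'=g'_1\cdots g'_r$ be the unique arrangement of the descent bottoms of $\sigma$ such that $\#\{a>b: g'_a<g'_b\}=(31\!-\!2)_{g_b}(\sigma)$ for all $b$. Then $\Phi_C(\sigma)$ is the permutation $\tau$ with $\tau(f_b)=f'_b$ for all $b\in[m]$ and $\tau(g_b)=g'_b$ for all $b\in[r]$. The map $\Phi_{SZ}$ is defined in exactly the same way with $(2\!-\!31)_{f_b}(\sigma)$ and $(2\!-\!31)_{g_b}(\sigma)$ in place of $(31\!-\!2)_{f_b}(\sigma)$ and $(31\!-\!2)_{g_b}(\sigma)$. (Example: for $\sigma=412796583$,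 $\Phi_C(\sigma)=724183965$ and $\Phi_{SZ}(\sigma)=249385716$.) *)

(* Defs.v *)
From HB Require Import structures.
From mathcomp Require Import all_boot all_fingroup ssralg ssrint.

Set Implicit Arguments.
Unset Strict Implicit.
Unset Printing Implicit Defensive.

(* The set [n] is encoded by 'I_n = {0, ..., n-1}, and the word of s : 'S_n is
   s 0, ..., s (n-1): both positions and letters are shifted down by one.  Every
   statistic below depends only on comparisons or differences of positions and
   letters, except the two sums in NDdif, where the shift is undone. *)

Section Statistics.
Variable n : nat.
Implicit Types (s t : 'S_n) (k l i j : 'I_n) (p : 'I_n * 'I_n).

(* p is a pair (i, i+1) of adjacent positions. *)
Definition adjacent p : bool := p.2 == p.1.+1 :> nat.

Definition descents s : {set 'I_n * 'I_n} :=
  [set p | adjacent p && (s p.2 < s p.1)].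
Definition desc_tops s : {set 'I_n} := [set s p.1 | p in descents s].
Definition desc_bots s : {set 'I_n} := [set s p.2 | p in descents s].
Definition ndesc_tops s : {set 'I_n} := ~: desc_tops s.
Definition ndesc_bots s : {set 'I_n} := ~: desc_bots s.

Definition position s k : 'I_n := (s^-1)%g k.

Definition des s : nat := #|descents s|.
Definition ndes s : nat := n - des s.

Definition NDdif s : int :=
  ((\sum_(k in ndesc_bots s) (k.+1)%:Z) - (\sum_(k in ndesc_tops s) (k.+1)%:Z))%R.

Definition lr_max s k : bool := [forall l, (position s l < position s k) ==> (l < k)].
Definition rl_min s k : bool := [forall l, (position s k < position s l) ==> (k < l)].

Definition fmax s : nat := #|[set k in ndesc_tops s | lr_max s k]|.
Definition pmin s : nat := #|[set k in ndesc_bots s | rl_min s k]|.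

Definition pat31_2_at s k : nat :=
  #|[set p : 'I_n * 'I_n | [&& adjacent p, p.2 < position s k & s p.2 < k < s p.1]]|.
Definition pat2_31_at s k : nat :=
  #|[set p : 'I_n * 'I_n | [&& adjacent p, position s k < p.1 & s p.2 < k < s p.1]]|.
Definition pat31_2 s : nat := \sum_k pat31_2_at s k.
Definition pat2_31 s : nat := \sum_k pat2_31_at s k.

Definition MAD s : nat := des s + pat31_2 s + 2 * pat2_31 s.
Definition MADL s : nat := des s + pat2_31 s + 2 * pat31_2 s.

Definition wex t : nat := #|[set i : 'I_n | i <= t i]|.
Definition nfix t : nat := #|[set i : 'I_n | t i == i]|.
Definition inversions t : nat := #|[set p : 'I_n * 'I_n | (p.1 < p.2) && (t p.2 < t p.1)]|.
Definition depth t : nat := \sum_(i : 'I_n | i < t i) (t i - i).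
Definition cros t : nat :=
  #|[set p : 'I_n * 'I_n | let: (i, j) := p in
       [&& i < j, j <= t i & t i < t j] || [&& j < i, t i < j & t j < t i]]|.
Definition nest t : nat :=
  #|[set p : 'I_n * 'I_n | let: (i, j) := p in
       [&& i < j, j <= t j & t j < t i] || [&& j < i, t j < j & t i < t j]]|.

End Statistics.

Section Arrangements.
Variables n m : nat.
Implicit Types (A : {set 'I_n}) (w : {ffun 'I_m -> 'I_n}) (c : 'I_m -> nat).

Definition arrangement A w : bool := injectiveb w && ([set w b | b : 'I_m] == A).

Definition left_inversions w c : bool :=
  [forall b : 'I_m, #|[set a : 'I_m | (a < b) && (w b < w a)]| == c b].
Definition right_inversions w c : bool :=
  [forall b : 'I_m, #|[set a : 'I_m | (b < a) && (w a < w b)]| == c b].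

End Arrangements.

(* t is obtained from s through the statistic c on letters.  For A a set of
   ordinals, enum_val lists A in increasing order, so that enum_val b is f_b
   (resp. g_b) for A the set of nondescent (resp. descent) tops of s. *)
Definition is_Phi n (c : 'I_n -> nat) (s t : 'S_n) : bool :=
  [exists f' : {ffun 'I_#|ndesc_tops s| -> 'I_n},
   exists g' : {ffun 'I_#|desc_tops s| -> 'I_n},
   [&& arrangement (ndesc_bots s) f',
       left_inversions f' (fun b => c (enum_val b)),
       arrangement (desc_bots s) g',
       right_inversions g' (fun b => c (enum_val b)),
       [forall b, t (enum_val b) == f' b] &
       [forall b, t (enum_val b) == g' b]]].

(* Existence and uniqueness of t in is_Phi c s t, for every c such that c k is
   at most the number of descents of s jumping down across the letter k; this
   covers (31-2)_k and (2-31)_k. *)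

Lemma rank_exists n (r : rel 'I_n) (A : {set 'I_n}) m c :
    irreflexive r -> transitive r -> (forall x y, x != y -> r x y || r y x) ->
    #|A| = m.+1 -> c <= m ->
  exists2 x, x \in A & forall y, y \in A ->
    (#|[set z in A | r y z]| == c) = (y == x).
Proof.
move=> rI rT rC cA lecm; pose h y := #|[set z in A | r y z]|.
have hlt y z : y \in A -> z \in A -> r y z -> h z < h y.
  move=> yA zA ryz; apply: proper_card; apply/properP; split.
    apply/subsetP=> u; rewrite !inE => /andP[-> rzu] /=; exact: rT ryz rzu.
  by exists z; rewrite !inE ?zA ?ryz ?rI.
have hI : {in A &, injective h}.
  move=> y z yA zA eh; case: (eqVneq y z) => // /rC /orP[] rr.
    by have := hlt _ _ yA zA rr; rewrite eh ltnn.
  by have := hlt _ _ zA yA rr; rewrite eh ltnn.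
have hle y : y \in A -> h y < m.+1.
  move=> yA; rewrite -cA; apply: proper_card; apply/properP; split.
    by apply/subsetP=> u; rewrite !inE => /andP[].
  by exists y; rewrite // !inE rI andbF.
pose H y : 'I_m.+1 := inord (h y).
have HI : {in A &, injective H}.
  move=> y z yA zA /(congr1 val); rewrite /= !inordK ?hle //; exact: hI.
have: inord c \in H @: A.
  have -> : H @: A = setT.
    by apply/eqP; rewrite eqEcard subsetT cardsT card_ord (card_in_imset HI) cA /=.
  by rewrite inE.
case/imsetP=> x xA /(congr1 val); rewrite /= !inordK ?hle // => cx.
exists x => // y yA; rewrite -/(h y) cx; apply/eqP/eqP => [|-> //]; exact: hI.
Qed.

Lemma code_exists n (r : rel 'I_n) m (A : {set 'I_n}) (c : 'I_m -> nat) :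
    irreflexive r -> transitive r -> (forall x y, x != y -> r x y || r y x) ->
    #|A| = m -> (forall b : 'I_m, c b <= b) ->
  exists! w : {ffun 'I_m -> 'I_n}, arrangement A w /\
    forall b : 'I_m, #|[set a : 'I_m | (a < b) && r (w b) (w a)]| = c b.
Proof.
move=> rI rT rC; elim: m A c => [|m IH] A c cA cb.
  exists (ffun0 (card_ord 0)); split=> [|w' _]; last by apply/ffunP=> -[].
  split=> [|[] //]; apply/andP; split; first by apply/injectiveP=> -[].
  by rewrite (cards0_eq cA); apply/eqP/setP=> y; rewrite inE; apply/imsetP=> -[[]].
have [x xA xP] := rank_exists rI rT rC cA (cb ord_max).
pose d (b : 'I_m) := c (lift ord_max b).
have cAx : #|A :\ x| = m by move: cA; rewrite (cardsD1 x) xA => -[].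
have db (b : 'I_m) : d b <= b by have := cb (lift ord_max b); rewrite lift_max.
have low (u : 'I_m.+1 -> 'I_n) (b : 'I_m) :
   #|[set a : 'I_m.+1 | (a < lift ord_max b) && r (u (lift ord_max b)) (u a)]| =
   #|[set a : 'I_m | (a < b) && r (u (lift ord_max b)) (u (lift ord_max a))]|.
  rewrite -[RHS](card_imset _ (@lift_inj _ ord_max)); apply: eq_card => a.
  rewrite !inE; apply/idP/imsetP => [/andP[lt ra]|[a' + ->]].
    case: (unliftP ord_max a) => [a' ea|ea].
      by exists a'; rewrite // inE -ea ra andbT; move: lt; rewrite ea !lift_max.
    by move: lt; rewrite ea lift_max /= ltnNge ltnW.
  by rewrite inE !lift_max.
have top (u : {ffun 'I_m.+1 -> 'I_n}) : arrangement A u ->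
   #|[set a : 'I_m.+1 | (a < (ord_max : 'I_m.+1)) && r (u ord_max) (u a)]| =
   #|[set z in A | r (u ord_max) z]|.
  case/andP=> /injectiveP uI /eqP uA; rewrite -[LHS](card_imset _ uI).
  apply: eq_card => z; rewrite !inE; apply/imsetP/andP.
    by case=> a; rewrite inE => /andP[_ ra] ->; rewrite -uA imset_f.
  case; rewrite -uA => /imsetP[a _ ->] ra; exists a; rewrite // inE ra andbT.
  rewrite ltn_neqAle leq_ord andbT; apply/eqP => ea.
  by move: ra; rewrite (_ : a = ord_max) ?rI //; apply: val_inj.
have [w [[/andP[/injectiveP wI /eqP wA] wc] wU]] := IH _ _ cAx db.
pose W := [ffun b => if unlift ord_max b is Some b' then w b' else x].
have Wl b : W (lift ord_max b) = w b by rewrite ffunE liftK.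
have Wm : W ord_max = x by rewrite ffunE unlift_none.
have wx b : w b \in A :\ x by rewrite -wA imset_f.
have WA : arrangement A W.
  apply/andP; split.
    apply/injectiveP=> a b.
    case: (unliftP ord_max a) => [a'|] ->; case: (unliftP ord_max b) => [b'|] ->;
      rewrite ?Wl ?Wm // => e.
    - by rewrite (wI _ _ e).
    - by have := wx a'; rewrite e !inE eqxx.
    - by have := wx b'; rewrite -e !inE eqxx.
  apply/eqP/setP=> y; apply/imsetP/idP => [[b _ ->]|yA].
    case: (unliftP ord_max b) => [b'|] ->; rewrite ?Wl ?Wm //.
    by have := wx b'; rewrite !inE => /andP[].
  have [->|yx] := eqVneq y x; first by exists ord_max.
  have : y \in A :\ x by rewrite !inE yx.
  by rewrite -wA => /imsetP[b _ ->]; exists (lift ord_max b); rewrite ?Wl.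
exists W; split; first split=> // b.
  case: (unliftP ord_max b) => [b'|] ->.
    rewrite low Wl -[RHS]wc; apply: eq_card => a; by rewrite !inE Wl.
  by rewrite top // Wm; apply/eqP; rewrite xP.
move=> u [uA uc].
have um : u ord_max = x.
  have uin : u ord_max \in A by case/andP: uA => _ /eqP <-; rewrite imset_f.
  by apply/eqP; rewrite -xP // -top // uc.
have [/injectiveP uI /eqP uE] := andP uA.
have wu : w = [ffun b => u (lift ord_max b)].
  apply: wU; split.
    apply/andP; split.
      by apply/injectiveP=> a b; rewrite !ffunE => /uI /lift_inj.
    apply/eqP/setP=> y; rewrite !inE; apply/imsetP/andP.
      case=> b _ ->; rewrite ffunE -uE imset_f // -um; split=> //.
      by apply/eqP=> /uI /eqP; rewrite eq_sym (negbTE (neq_lift _ _)).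
    case=> yx; rewrite -uE => /imsetP[b _ ey]; move: yx; rewrite ey.
    case: (unliftP ord_max b) => [b'|] ->; last by rewrite um eqxx.
    by exists b'; rewrite ?ffunE.
  move=> b; rewrite /d -uc low; apply: eq_card => a; by rewrite !inE !ffunE.
apply/ffunP=> b; case: (unliftP ord_max b) => [b'|] ->.
  by rewrite Wl wu ffunE.
by rewrite Wm um.
Qed.

Lemma left_exists n m (A : {set 'I_n}) (c : 'I_m -> nat) :
    #|A| = m -> (forall b : 'I_m, c b <= b) ->
  exists! w, arrangement A w && left_inversions w c.
Proof.
move=> cA cb; have [||x y nxy|w [[wA wc] wU]] :=
  @code_exists n (fun x y => x < y) m A c _ _ _ cA cb.
- by move=> x; rewrite ltnn.
- by move=> y x z; apply: ltn_trans.
- by rewrite -neq_ltn.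
exists w; split; first by rewrite wA; apply/forallP=> b; rewrite wc.
by move=> u /andP[uA /forallP uc]; apply: wU; split=> // b; apply/eqP.
Qed.

Lemma ltn_rev_ord m (a b : 'I_m) : (rev_ord a < rev_ord b) = (b < a).
Proof. by rewrite /= ltn_sub2lE. Qed.

Lemma right_exists n m (A : {set 'I_n}) (c : 'I_m -> nat) :
    #|A| = m -> (forall b : 'I_m, c b <= m - b.+1) ->
  exists! w, arrangement A w && right_inversions w c.
Proof.
move=> cA cb; pose d b := c (rev_ord b).
have db (b : 'I_m) : d b <= b.
  by apply: leq_trans (cb _) _; rewrite /= subnSK // subKn // ltnW.
have [||x y nxy|w [[wA wc] wU]] :=
  @code_exists n (fun x y => y < x) m A d _ _ _ cA db.
- by move=> x; rewrite ltnn.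
- by move=> y x z yx zy; apply: ltn_trans zy yx.
- by rewrite orbC -neq_ltn.
pose R (u : {ffun 'I_m -> 'I_n}) := [ffun b => u (rev_ord b)].
have RK u : R (R u) = u by apply/ffunP=> b; rewrite !ffunE rev_ordK.
have RA u : arrangement A u -> arrangement A (R u).
  case/andP=> /injectiveP uI /eqP uA; apply/andP; split.
    by apply/injectiveP=> a b; rewrite !ffunE => /uI /rev_ord_inj.
  apply/eqP/setP=> y; rewrite -uA; apply/imsetP/imsetP=> -[b _ ->].
    by rewrite ffunE; exists (rev_ord b).
  by exists (rev_ord b); rewrite ?ffunE ?rev_ordK.
have Rc (u : {ffun 'I_m -> 'I_n}) (b : 'I_m) :
    #|[set a : 'I_m | (b < a) && (R u a < R u b)]| =
    #|[set a : 'I_m | (a < rev_ord b) && (u a < u (rev_ord b))]|.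
  rewrite -[RHS](card_imset _ rev_ord_inj); apply: eq_card => a.
  rewrite inE; apply/idP/imsetP => [h|[a' + ->]].
    by exists (rev_ord a); rewrite ?rev_ordK // inE ltn_rev_ord; move: h; rewrite !ffunE.
  by rewrite inE !ffunE -(ltn_rev_ord (rev_ord a')) !rev_ordK.
exists (R w); split.
  by rewrite RA //; apply/forallP=> b; rewrite Rc wc /d rev_ordK.
move=> u /andP[uA /forallP uc]; rewrite (_ : w = R u) ?RK //.
apply: wU; split=> [|b]; first exact: RA.
by have := Rc (R u) (rev_ord b); rewrite RK rev_ordK => <-; apply/eqP.
Qed.

Definition down_jumps n (s : 'S_n) (k : 'I_n) : {set 'I_n * 'I_n} :=
  [set p | adjacent p && (s p.2 < k < s p.1)].

Lemma adjacent_inj1 n (D : {set 'I_n * 'I_n}) (s : 'S_n) :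
  {subset D <= @adjacent n} -> {in D &, injective (fun p => s p.1)}.
Proof.
move=> sD [a b] [a' b'] /sD /eqP /= e /sD /eqP /= e' /perm_inj ea.
by rewrite -ea in e' *; congr (_, _); apply: val_inj; rewrite /= e e'.
Qed.

Lemma adjacent_inj2 n (D : {set 'I_n * 'I_n}) (s : 'S_n) :
  {subset D <= @adjacent n} -> {in D &, injective (fun p => s p.2)}.
Proof.
move=> sD [a b] [a' b'] /sD /eqP /= e /sD /eqP /= e' /perm_inj eb.
rewrite -eb in e' *; congr (_, _); apply: val_inj.
by move: e'; rewrite e => -[].
Qed.

Lemma down_jumps_desc_tops n (s : 'S_n) k :
  #|down_jumps s k| <= #|[set l in desc_tops s | k < l]|.
Proof.
have sub : {subset down_jumps s k <= @adjacent n} by move=> p; rewrite inE => /andP[].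
rewrite -(card_in_imset (adjacent_inj1 (s := s) sub)); apply: subset_leq_card.
apply/subsetP=> _ /imsetP[p + ->]; rewrite !inE => /and3P[ap lt1 lt2].
rewrite lt2 andbT; apply/imsetP; exists p => //.
by rewrite inE ap (ltn_trans lt1 lt2).
Qed.

Lemma card_desc_tops n (s : 'S_n) : #|desc_tops s| = #|desc_bots s|.
Proof.
have sub : {subset descents s <= @adjacent n} by move=> p; rewrite inE => /andP[].
by rewrite !card_in_imset //; [apply: adjacent_inj2 | apply: adjacent_inj1].
Qed.

Lemma down_jumps_ndesc_tops n (s : 'S_n) (k : 'I_n) :
  #|down_jumps s k| <= #|[set l in ndesc_tops s | l < k]|.
Proof.
pose B := [set l : 'I_n | l < k].
pose D := [set p in descents s | s p.1 < k].
have sD : {subset D <= @adjacent n}.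
  by move=> p; rewrite !inE => /andP[/andP[]].
have sU : {subset D :|: down_jumps s k <= @adjacent n}.
  by move=> p; rewrite !inE => /orP[/andP[/andP[]]|/andP[]].
have -> : [set l in ndesc_tops s | l < k] = B :\: [set s p.1 | p in D].
  apply/setP=> l; rewrite !inE; case lk: (l < k); rewrite ?andbF ?andbT //.
  congr (~~ _); apply/imsetP/imsetP=> -[p pD el]; exists p => //.
    by rewrite inE pD -el.
  by move: pD; rewrite inE => /andP[].
have DB : [set s p.1 | p in D] \subset B.
  by apply/subsetP=> _ /imsetP[p + ->]; rewrite !inE => /andP[].
rewrite cardsD (setIidPr DB) (card_in_imset (adjacent_inj1 sD)).
rewrite leq_subRL; last first.
  by rewrite -(card_in_imset (adjacent_inj1 (s := s) sD)) subset_leq_card.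
have dis : D :&: down_jumps s k = set0.
  apply/setP=> p; rewrite !inE; apply/negP => /andP[/andP[_ lt1]].
  by move=> /and3P[_ _ lt2]; move: (ltn_trans lt1 lt2); rewrite ltnn.
rewrite -cardsUI dis cards0 addn0.
rewrite -(card_in_imset (adjacent_inj2 (s := s) sU)); apply: subset_leq_card.
apply/subsetP=> _ /imsetP[p + ->]; rewrite !inE.
case/orP=> [/andP[/andP[_ lt1] lt2]|/and3P[]//]; exact: ltn_trans lt1 lt2.
Qed.

Lemma enum_val_ltn n (A : {set 'I_n}) (a b : 'I_#|A|) :
  (enum_val a < enum_val b) = (a < b).
Proof.
have lt (i j : 'I_#|A|) : i < j -> enum_val i < enum_val j.
  move=> ij; have x0 : 'I_n := enum_val a.
  rewrite (enum_val_nth x0 i) (enum_val_nth x0 j).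
  apply: (sorted_ltn_nth (leT := fun x y : 'I_n => x < y)) => //.
  - by move=> y x z; apply: ltn_trans.
  - rewrite /enum_mem; apply: sorted_filter; first by move=> y x z; apply: ltn_trans.
    by rewrite -enumT -(sorted_map (f := val) (e' := ltn)) val_enum_ord iota_ltn_sorted.
  - by rewrite inE -cardE.
  - by rewrite inE -cardE.
case: (ltngtP a b) => [/lt // | /lt ba | /val_inj ->]; last by rewrite ltnn.
by rewrite ltnNge ltnW.
Qed.

Lemma card_ltn m (b : 'I_m) : #|[set a : 'I_m | a < b]| = b.
Proof.
rewrite -sum1_card (eq_bigl (fun a : 'I_m => a < b)) => [|a]; last by rewrite inE.
by rewrite (big_ord_narrow (ltnW (ltn_ord b))) sum1_card card_ord.
Qed.

Lemma card_below n (A : {set 'I_n}) (b : 'I_#|A|) :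
  #|[set l in A | l < enum_val b]| <= b.
Proof.
rewrite -[leqRHS]card_ltn -[leqRHS](card_imset _ (@enum_val_inj _ (mem A))).
apply: subset_leq_card; apply/subsetP=> l; rewrite inE => /andP[lA lb].
apply/imsetP; exists (enum_rank_in lA l); last by rewrite enum_rankK_in.
by rewrite inE -enum_val_ltn enum_rankK_in.
Qed.

Lemma card_above n (A : {set 'I_n}) (b : 'I_#|A|) :
  #|[set l in A | enum_val b < l]| <= #|A| - b.+1.
Proof.
have -> : #|A| - b.+1 = #|[set a : 'I_#|A| | b < a]|.
  rewrite -[LHS](card_ltn (rev_ord b)) -[LHS](card_imset _ (@rev_ord_inj _)).
  apply: eq_card => a; rewrite [RHS]inE; apply/imsetP/idP => [[a' + ->]|ba].
    by rewrite inE -(ltn_rev_ord (rev_ord a')) rev_ordK.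
  by exists (rev_ord a); rewrite ?rev_ordK // inE ltn_rev_ord.
rewrite -[leqRHS](card_imset _ (@enum_val_inj _ (mem A))).
apply: subset_leq_card; apply/subsetP=> l; rewrite inE => /andP[lA lb].
apply/imsetP; exists (enum_rank_in lA l); last by rewrite enum_rankK_in.
by rewrite inE -enum_val_ltn enum_rankK_in.
Qed.

Lemma is_Phi_exists n (c : 'I_n -> nat) (s : 'S_n) :
    (forall k, c k <= #|down_jumps s k|) ->
  exists! t : 'S_n, is_Phi c s t.
Proof.
move=> cle.
have [||f [/andP[fA fc] fU]] := @left_exists n #|ndesc_tops s| (ndesc_bots s)
    (fun b => c (enum_val b)).
- apply/eqP; rewrite -(eqn_add2l #|desc_tops s|) cardsC.
  by rewrite card_desc_tops cardsC.
- move=> b; apply: leq_trans (card_below b).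
  exact: leq_trans (cle _) (down_jumps_ndesc_tops _ _).
have [||g [/andP[gA gc] gU]] := @right_exists n #|desc_tops s| (desc_bots s)
    (fun b => c (enum_val b)).
- by rewrite card_desc_tops.
- move=> b; apply: leq_trans (card_above b).
  exact: leq_trans (cle _) (down_jumps_desc_tops _ _).
have [/injectiveP fI /eqP fE] := andP fA.
have [/injectiveP gI /eqP gE] := andP gA.
have inN k : ~ (k \in desc_tops s) -> k \in ndesc_tops s.
  by rewrite inE => /negP.
pose h k := if [pick b : 'I_#|desc_tops s| | enum_val b == k] is Some b then g b
  else if [pick b : 'I_#|ndesc_tops s| | enum_val b == k] is Some b then f b
  else k.
have hT (b : 'I_#|desc_tops s|) : h (enum_val b) = g b.
  rewrite /h; case: pickP => [b' /eqP /enum_val_inj -> //|/(_ b)].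
  by rewrite eqxx.
have hN (b : 'I_#|ndesc_tops s|) : h (enum_val b) = f b.
  rewrite /h; case: pickP => [b' /eqP e|_].
    by have := enum_valP b; rewrite -e inE enum_valP.
  case: pickP => [b' /eqP /enum_val_inj -> //|/(_ b)].
  by rewrite eqxx.
have split k : (exists b : 'I_#|desc_tops s|, k = enum_val b)
            \/ (exists b : 'I_#|ndesc_tops s|, k = enum_val b).
  case: (boolP (k \in desc_tops s)) => [kT|/negP/inN kN].
    by left; exists (enum_rank_in kT k); rewrite enum_rankK_in.
  by right; exists (enum_rank_in kN k); rewrite enum_rankK_in.
have dis a b : f a <> g b.
  move=> e; have: f a \in ndesc_bots s by rewrite -fE imset_f.
  by rewrite e inE -gE imset_f.
have hI : injective h.
  move=> k l; case: (split k) => -[a ->]; case: (split l) => -[b ->];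
    rewrite ?hT ?hN.
  - by move/gI->.
  - by move/esym/dis.
  - by move/dis.
  - by move/fI->.
exists (perm hI); split.
  apply/existsP; exists f; apply/existsP; exists g.
  rewrite fA fc gA gc /=; apply/andP; split; apply/forallP=> b; rewrite permE.
    by rewrite hN.
  by rewrite hT.
move=> t /existsP[f' /existsP[g' /and5P[fA' fc' gA' gc' /andP[/forallP tf /forallP tg]]]].
have ef : f = f' by apply: fU; rewrite fA' fc'.
have eg : g = g' by apply: gU; rewrite gA' gc'.
apply/permP=> k; rewrite permE; case: (split k) => -[b ->].
  by rewrite hT (eqP (tg b)) eg.
by rewrite hN (eqP (tf b)) ef.
Qed.

Lemma pat31_2_at_le n (s : 'S_n) k : pat31_2_at s k <= #|down_jumps s k|.
Proof.
by apply: subset_leq_card; apply/subsetP=> p; rewrite !inE => /and3P[-> _ ->].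
Qed.

Lemma pat2_31_at_le n (s : 'S_n) k : pat2_31_at s k <= #|down_jumps s k|.
Proof.
by apply: subset_leq_card; apply/subsetP=> p; rewrite !inE => /and3P[-> _ ->].
Qed.

Lemma Phi_C_unique n (s : 'S_n) : exists! t, is_Phi (pat31_2_at s) s t.
Proof. exact: is_Phi_exists (pat31_2_at_le s). Qed.

Lemma Phi_SZ_unique n (s : 'S_n) : exists! t, is_Phi (pat2_31_at s) s t.
Proof. exact: is_Phi_exists (pat2_31_at_le s). Qed.

Lemma Phi_C_exists n (s : 'S_n) : exists t, is_Phi (pat31_2_at s) s t.
Proof. by have [t [tP _]] := Phi_C_unique s; exists t. Qed.

Lemma Phi_SZ_exists n (s : 'S_n) : exists t, is_Phi (pat2_31_at s) s t.
Proof. by have [t [tP _]] := Phi_SZ_unique s; exists t. Qed.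

Definition Phi_C n (s : 'S_n) : 'S_n := xchoose (Phi_C_exists s).
Definition Phi_SZ n (s : 'S_n) : 'S_n := xchoose (Phi_SZ_exists s).

(* finv is the inverse of an injective self-map of a finite type. *)
Definition Phi_star n : 'S_n -> 'S_n := @Phi_SZ n \o finv (@Phi_C n).

(* Main.v *)
Require Import Defs.
From mathcomp Require Import all_boot all_fingroup ssralg ssrint.
From mathcomp Require Import zify.

Set Implicit Arguments.
Unset Strict Implicit.
Unset Printing Implicit Defensive.

(** Why the theorem is true.  Let t be the image of s under one of the two maps,
    F and G the nondescent and descent tops of s, and c the statistic on letters
    that the map encodes.  Read on letters, the definition of the map says that
    t carries F and G onto the nondescent and descent bottoms, and that for k in
    F (resp. G) the number of l < k in F with t l > t k (resp. of l > k in G with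
    t l < t k) is c k; this is [coded].

    The excess of the number of descent bottoms below k over the number of
    descent tops below k counts the descents of s that jump down across k or
    start at k.  Since c k is at most the number of descents across k, this
    leaves too few small values for t k < k with k in F, or t k >= k with k in G,
    to be possible ([coded_ndesc_top_le], [coded_desc_top_gt]).  So F is the set
    of weak excedances of t, which gives wex and depth.  Moreover c k is exactly
    the number of nestings of t at k, and nestings and crossings at k together
    count the other arcs of t passing over k, hence the descents of s jumping across k
    ([coded_cros_nest_at]).  As (31-2)_k + (2-31)_k is the same number, the
    crossings at k count the other of the two patterns.  For inv two identities
    valid for every permutation remain: inv = depth + nest and
    depth = cros + nest + (n - wex).  A fixed point of t is a letter that is
    both a weak excedance and the image of one and has no crossing; under the
    dictionary it is a right-to-left minimum, resp. a left-to-right maximum.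

    Bijectivity is injectivity: from t one reads off the descent tops, the
    descent bottoms, and both patterns at every letter of s, and these data
    determine s ([descents_pat31_2_inj]).  Insert the letters of s in increasing
    order, remembering which gaps between the letters inserted so far will
    receive larger letters: (31-2)_k is the number of such gaps to the left of
    k, so it tells where k goes, and whether k is a descent top or bottom tells
    which gaps beside k remain open.  The statement on Phi_star follows by
    comparing the two dictionaries at the common preimage. *)

(** * Counting with indicator sums *)

(** Identities between cardinals are proved below by comparing indicator
    functions pointwise. *)
Lemma card_set_sum (T : finType) (P : pred T) : #|[set x | P x]| = \sum_x (P x : nat).
Proof. by rewrite -sum1dep_card big_mkcond; apply: eq_bigr => x _; case: (P x). Qed.

Lemma card_pairs (T : finType) (P : pred (T * T)) :
  #|[set p | P p]| = \sum_j #|[set i | P (i, j)]|.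
Proof.
rewrite card_set_sum (eq_bigr (fun p => P (p.1, p.2) : nat)) => [|[]] //.
rewrite -(pair_bigA _ (fun i j => P (i, j) : nat)) exchange_big.
by apply: eq_bigr => j _; rewrite card_set_sum.
Qed.

Lemma sum_eq1 (T : finType) (x : T) : \sum_y (y == x : nat) = 1.
Proof. by rewrite -card_set_sum -(cards1 x); apply: eq_card => y; rewrite !inE. Qed.

(** Lets linear arithmetic use the injectivity of a permutation. *)
Lemma perm_val_eq n (t : 'S_n) i k : (t i == t k :> nat) = (i == k :> nat).
Proof. exact: (inj_eq (@perm_inj _ t)). Qed.

Definition below n (A : {set 'I_n}) (k : nat) := #|[set l in A | l < k]|.

Lemma below_sum n (A : {set 'I_n}) k : below A k = \sum_l ((l \in A) && (l < k) : nat).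
Proof. exact: card_set_sum. Qed.

Lemma below_perm n (t : 'S_n) (A : {set 'I_n}) k :
  below (t @: A) k = \sum_l ((l \in A) && (t l < k) : nat).
Proof.
rewrite -card_set_sum -(card_imset _ (@perm_inj _ t)); apply: eq_card => x.
rewrite inE; apply/andP/imsetP => [[/imsetP[l lA ->] lk]|[l + ->]].
  by exists l; rewrite // inE lA.
by rewrite inE => /andP[lA lk]; rewrite imset_f.
Qed.

Lemma below_setC n (A : {set 'I_n}) k :
  below A k + below (~: A) k = \sum_(l < n) (l < k : nat).
Proof.
rewrite !below_sum -big_split; apply: eq_bigr => l _ /=.
by rewrite inE; case: (l \in A); case: (l < k).
Qed.

(** * Nestings, crossings and inversions of a permutation, letter by letter *)

Section Cyclic.
Variable n : nat.
Implicit Types (t : 'S_n) (i j k : 'I_n).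

Definition wexc t : {set 'I_n} := [set i : 'I_n | i <= t i].

Definition nest_at t j := if j <= t j then #|[set i : 'I_n | (i < j) && (t j < t i)]|
  else #|[set i : 'I_n | (j < i) && (t i < t j)]|.
Definition cros_at t j := if j <= t j then #|[set i : 'I_n | [&& i < j, j <= t i & t i < t j]]|
  else #|[set i : 'I_n | [&& j < i, t i < j & t j < t i]]|.

(** Drawing an arc from i to t i, this counts the rising arcs passing over the gap
    just before k; by [arcs_over_sym] as many falling arcs do. *)
Definition arcs_over t (k : nat) := #|[set i : 'I_n | i < k <= t i]|.

Lemma nest_sum t : nest t = \sum_j nest_at t j.
Proof.
rewrite /nest card_pairs; apply: eq_bigr => j _; rewrite /nest_at.
case: leqP => h; apply: eq_card => i; rewrite !inE /=; lia.
Qed.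

Lemma cros_sum t : cros t = \sum_j cros_at t j.
Proof.
rewrite /cros card_pairs; apply: eq_bigr => j _; rewrite /cros_at.
case: leqP => h; apply: eq_card => i; rewrite !inE /=; lia.
Qed.

Lemma sum_ord_ltn (k : nat) : k <= n -> \sum_(l < n) (l < k : nat) = k.
Proof.
move=> kn; rewrite -(card_set_sum (fun l : 'I_n => l < k)) -sum1dep_card.
by rewrite (big_ord_narrow kn) sum1_card card_ord.
Qed.

Lemma arcs_over_sym t (k : nat) : arcs_over t k = #|[set i : 'I_n | t i < k <= i]|.
Proof.
rewrite /arcs_over !card_set_sum.
apply: (@addnI (\sum_(i : 'I_n) ((i < k) && (t i < k) : nat))); rewrite -!big_split /=.
transitivity (\sum_(i : 'I_n) (i < k : nat)).
  apply: eq_bigr => i _; lia.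
rewrite (reindex_inj (@perm_inj _ t)) /=; apply: eq_bigr => i _; lia.
Qed.

(** The rising arcs over a weak excedance k cross or nest the arc of k according
    to their target; for k > t k, count instead the falling arcs, among which is
    the arc of k itself. *)
Lemma cros_nest_at t k : cros_at t k + nest_at t k + (k \notin wexc t) = arcs_over t k.
Proof.
rewrite /cros_at /nest_at inE; case: leqP => h.
  rewrite addn0 /arcs_over !card_set_sum -big_split; apply: eq_bigr => i _ /=.
  by have := perm_val_eq t i k; lia.
rewrite /= arcs_over_sym !card_set_sum -(sum_eq1 k) -!big_split.
apply: eq_bigr => i _ /=; have := perm_val_eq t i k.
have : (i == k) = (i == k :> nat) by [].
have : i == k :> nat -> t i = t k :> nat by move/eqP/val_inj->.
lia.
Qed.

Lemma card_between (a b : nat) : b <= n ->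
  #|[set k : 'I_n | a <= k < b]| = b - a.
Proof.
move=> bn; rewrite card_set_sum; apply: (@addnI (minn a b)).
rewrite -[in LHS](@sum_ord_ltn (minn a b)) ?geq_min ?bn ?orbT // -big_split /=.
transitivity (\sum_(k < n) (k < b : nat)); last by rewrite sum_ord_ltn //; lia.
apply: eq_bigr => k _; lia.
Qed.

(** Double counting: a rising arc from i to t i passes over t i - i letters. *)
Lemma depth_arcs_over t : depth t = \sum_(k < n) arcs_over t k.
Proof.
rewrite /depth big_mkcond /=.
transitivity (\sum_(i < n) (t i - i)).
  apply: eq_bigr => i _; case: ifP => //; lia.
under [RHS]eq_bigr => k _ do rewrite /arcs_over card_set_sum.
rewrite exchange_big; apply: eq_bigr => i _ /=.
rewrite -subSS -card_between // card_set_sum; apply: eq_bigr => k _; lia.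
Qed.

Lemma depth_cros_nest t : depth t = cros t + nest t + (n - wex t).
Proof.
rewrite depth_arcs_over cros_sum nest_sum -big_split /=.
have -> : n - wex t = \sum_k (k \notin wexc t : nat).
  have -> : wex t = #|wexc t| by [].
  rewrite -card_set_sum; have := cardsC (wexc t); rewrite card_ord.
  have -> : ~: wexc t = [set k | k \notin wexc t] by apply/setP=> k; rewrite !inE.
  by lia.
by rewrite -big_split; apply: eq_bigr => k _; rewrite -cros_nest_at.
Qed.

(** The equality holds for each left end i of an inversion: if i <= t i, then
    among the t i positions j with t j < t i those on the right of i exceed in
    number by t i - i the positions j on the left of i with t j > t i. *)
Lemma inversions_depth_nest t : inversions t = depth t + nest t.
Proof.
rewrite nest_sum /depth [in RHS]big_mkcond -big_split /= /inversions.
rewrite card_set_sum.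
rewrite (eq_bigr (fun p : 'I_n * 'I_n => (p.1 < p.2) && (t p.2 < t p.1) : nat)) //.
rewrite -(pair_bigA _ (fun i j : 'I_n => (i < j) && (t j < t i) : nat)).
apply: eq_bigr => i _ /=; rewrite /nest_at; case: (leqP i (t i)) => ti; last first.
  by rewrite card_set_sum; case: ltnP => // ?; lia.
apply: (@addnI (\sum_(j : 'I_n) ((j < i) && (t j < t i) : nat))).
have -> : (if i < t i then t i - i else 0) = t i - i by case: ltnP => //; lia.
rewrite card_set_sum addnCA -!big_split /=.
transitivity (\sum_j (t j < t i : nat)).
  by apply: eq_bigr => j _; have := perm_val_eq t j i; lia.
rewrite -(reindex_inj (@perm_inj _ t) (P := xpredT) (F := fun j => j < t i : nat)).
rewrite sum_ord_ltn ?(ltnW (ltn_ord _)) //.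
rewrite -[LHS](@subnK i) //; congr (_ + _).
rewrite -{1}(sum_ord_ltn (ltnW (ltn_ord i))); apply: eq_bigr => j _.
by have := perm_val_eq t i j; lia.
Qed.

(** If k = t i with i a weak excedance other than k, then the arc from i to k
    meets the arc from k to t k at k, and this counts as a crossing at k. *)
Lemma fixed_cros_at t k :
  (t k == k) = [&& k \in wexc t, k \in t @: wexc t & cros_at t k == 0].
Proof.
apply/eqP/and3P => [tk|[kW /imsetP[i + ek] /eqP]].
  have kW : k \in wexc t by rewrite inE tk.
  split=> //; first by rewrite -{1}tk imset_f.
  rewrite /cros_at tk leqnn cards_eq0; apply/eqP/setP=> i; rewrite !inE; lia.
move: kW; rewrite !inE => kW iW; rewrite /cros_at kW.
move=> /eqP; rewrite cards_eq0 => /eqP/setP/(_ i); rewrite !inE -ek leqnn /= => h.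
case: (eqVneq i k) => [ik|ik]; first by rewrite -[in LHS]ik -ek.
have {}ik : i != k :> nat by [].
by have := perm_val_eq t i k; rewrite -ek; move: iW; rewrite -ek; lia.
Qed.

End Cyclic.

(** * Descents of a word and the letters they jump across *)

(** A discrete intermediate value property, used to find a descent across a
    letter between two positions of the word. *)
Lemma first_entry n (P : pred 'I_n) (i j : 'I_n) : i < j -> ~~ P i -> P j ->
  exists2 p, adjacent p & [&& i <= p.1, p.2 <= j, ~~ P p.1 & P p.2].
Proof.
move=> ij Pi Pj.
have ex : exists m, [exists l : 'I_n, [&& i < l, P l & l == m :> nat]].
  by exists j; apply/existsP; exists j; rewrite ij Pj eqxx.
case: (ex_minnP ex) => m /existsP[l /and3P[il Pl /eqP lm]] mmin.
have pl : l.-1 < n by apply: leq_ltn_trans (ltn_ord l); lia.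
exists (Ordinal pl, l); first by rewrite /adjacent /=; lia.
rewrite /= Pl andbT; apply/and3P; split; first by lia.
  by rewrite lm; apply: mmin; apply/existsP; exists j; rewrite ij Pj eqxx.
have [e|ne] := eqVneq (Ordinal pl) i; first by rewrite e.
have {}ne : l.-1 != i by [].
apply/negP=> Pl'; suff: m <= l.-1 by lia.
by apply: mmin; apply/existsP; exists (Ordinal pl); rewrite Pl' eqxx /=; lia.
Qed.

Section Words.
Variable n : nat.
Implicit Types (s t : 'S_n) (i j k l a b : 'I_n) (p : 'I_n * 'I_n).

Lemma positionK s k : s (position s k) = k.
Proof. exact: permKV. Qed.

Lemma perm_position s i : position s (s i) = i.
Proof. exact: permK. Qed.

Lemma position_inj s : injective (position s).
Proof. exact: perm_inj. Qed.

Lemma desc_topsP s k :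
  reflect (exists p, [/\ adjacent p, s p.2 < k & s p.1 = k]) (k \in desc_tops s).
Proof.
apply: (iffP imsetP) => [[p + ->]|[p [ap ltp ek]]].
  by rewrite inE => /andP[ap ltp]; exists p.
by exists p; rewrite // inE ap ek.
Qed.

Lemma desc_botsP s k :
  reflect (exists p, [/\ adjacent p, k < s p.1 & s p.2 = k]) (k \in desc_bots s).
Proof.
apply: (iffP imsetP) => [[p + ->]|[p [ap ltp ek]]].
  by rewrite inE => /andP[ap ltp]; exists p.
by exists p; rewrite // inE ap ek.
Qed.

(** The letters b < k whose predecessor in the word is at least k: they mark the
    gaps of the subword of letters < k that still have to receive letters.  The
    gap at the end of the word is left out. *)
Definition gap_bots s (k : nat) : {set 'I_n} :=
  [set s p.2 | p in [set p | adjacent p && (s p.2 < k <= s p.1)]].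

Lemma gap_botsP s (k : nat) b :
  reflect (exists p, [/\ adjacent p, b < k <= s p.1 & s p.2 = b]) (b \in gap_bots s k).
Proof.
apply: (iffP imsetP) => [[p + ->]|[p [ap ltp e]]].
  by rewrite inE => /andP[ap ltp]; exists p.
by exists p; rewrite // inE ap e.
Qed.

Lemma card_descents_tops s (P : pred 'I_n) :
  #|[set l in desc_tops s | P l]| = #|[set p in descents s | P (s p.1)]|.
Proof.
rewrite -(card_in_imset (f := fun p => s p.1) (D := [set p in descents s | P (s p.1)])).
  apply: eq_card => l; rewrite inE; apply/andP/imsetP => [[/imsetP[p pd ->] Pp]|[p + ->]].
    by exists p; rewrite // inE pd.
  by rewrite inE => /andP[pd Pp]; rewrite imset_f.
by apply: adjacent_inj1 => p; rewrite !inE => /andP[/andP[]].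
Qed.

Lemma card_descents_bots s (P : pred 'I_n) :
  #|[set l in desc_bots s | P l]| = #|[set p in descents s | P (s p.2)]|.
Proof.
rewrite -(card_in_imset (f := fun p => s p.2) (D := [set p in descents s | P (s p.2)])).
  apply: eq_card => l; rewrite inE; apply/andP/imsetP => [[/imsetP[p pd ->] Pp]|[p + ->]].
    by exists p; rewrite // inE pd.
  by rewrite inE => /andP[pd Pp]; rewrite imset_f.
by apply: adjacent_inj2 => p; rewrite !inE => /andP[/andP[]].
Qed.

(** A descent has its bottom below k but not its top exactly when it jumps
    across k or starts at k. *)
Lemma below_desc_bots s k :
  below (desc_bots s) k = below (desc_tops s) k + #|down_jumps s k| + (k \in desc_tops s).
Proof.
have -> : (k \in desc_tops s : nat) = #|[set l in desc_tops s | l == k]|.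
  case: (boolP (k \in desc_tops s)) => kT.
    rewrite -[LHS](cards1 k); apply: eq_card => l; rewrite !inE.
    by case: eqVneq => [->|]; rewrite ?kT ?andbF.
  apply/esym/eqP; rewrite cards_eq0; apply/eqP/setP=> l; rewrite !inE.
  by case: eqVneq => [->|]; rewrite ?andbF // (negbTE kT).
rewrite /below card_descents_bots !card_descents_tops !card_set_sum -!big_split.
apply: eq_bigr => p _; rewrite !inE /=.
have -> : (s p.1 == k) = (s p.1 == k :> nat) by [].
case: (adjacent p) => //=; lia.
Qed.

(** A descent across k lies on one side of the position of k. *)
Lemma down_jumps_split s k : #|down_jumps s k| = pat31_2_at s k + pat2_31_at s k.
Proof.
rewrite /pat31_2_at /pat2_31_at !card_set_sum -big_split; apply: eq_bigr => -[i j] _ /=.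
have [-> /=|ne1] := eqVneq i (position s k).
  by rewrite positionK !ltnn !andbF.
have [-> /=|ne2] := eqVneq j (position s k).
  by rewrite positionK !ltnn !andbF.
rewrite -!val_eqE /= in ne1 ne2.
rewrite /adjacent; case: eqP => //= ij; case: (s j < k < s i); lia.
Qed.

(** If some letter right of k is smaller than k, the first such letter ends a
    descent that starts at k or jumps across k. *)
Lemma rl_min_ndesc_top s k :
  rl_min s k = (k \in ndesc_tops s) && (pat2_31_at s k == 0).
Proof.
apply/forallP/andP => [h|[kN]].
  split; first rewrite inE.
    apply/desc_topsP=> -[[i j] /= [/eqP /= ij lt ek]].
    have /implyP := h (s j); rewrite perm_position -{1}ek perm_position; lia.
  rewrite cards_eq0; apply/eqP/setP=> -[i j]; rewrite !inE /=.
  apply/negP=> /and3P[/eqP /= ij lt].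
  have /implyP := h (s j); rewrite perm_position; lia.
rewrite cards_eq0 => /eqP/setP h l; apply/implyP=> kl; case: ltnP => // lk.
have [||[i j] /= ij /and4P[ki jl sik sjk]] := @first_entry n (fun i => s i < k) _ _ kl.
- by rewrite positionK ltnn.
- rewrite positionK ltn_neqAle lk andbT.
  by apply: contraTneq kl => /val_inj ->; rewrite ltnn.
have [e|ne] := eqVneq i (position s k).
  move: kN; rewrite inE => /desc_topsP[]; exists (i, j); split=> //=.
  by rewrite e positionK.
have : s i != k by apply: contra ne => /eqP <-; rewrite perm_position.
rewrite -!val_eqE /= in ne * => ne'.
have := h (i, j); rewrite !inE ij /=; lia.
Qed.

(** If some letter left of k is larger than k, then going from it to k the first
    letter that is at most k ends a descent; that letter is k or lies below k. *)
Lemma lr_max_ndesc_bot s k :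
  lr_max s k = (k \in ndesc_bots s) && (pat31_2_at s k == 0).
Proof.
apply/forallP/andP => [h|[kN]].
  split; first rewrite inE.
    apply/desc_botsP=> -[[i j] /= [/eqP /= ij lt ek]].
    have /implyP := h (s i); rewrite perm_position -{1}ek perm_position; lia.
  rewrite cards_eq0; apply/eqP/setP=> -[i j]; rewrite !inE /=.
  apply/negP=> /and3P[/eqP /= ij lt].
  have /implyP := h (s i); rewrite perm_position; lia.
rewrite cards_eq0 => /eqP/setP h l; apply/implyP=> kl; case: ltnP => // lk.
have [||[i j] /= ij /and4P[li jk sik sjk]] := @first_entry n (fun i => s i <= k) _ _ kl.
- rewrite positionK -ltnNge ltn_neqAle lk andbT.
  by apply: contraTneq kl => /val_inj ->; rewrite ltnn.
- by rewrite positionK.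
have [e|ne] := eqVneq j (position s k).
  move: kN; rewrite inE => /desc_botsP[]; exists (i, j); split=> //=.
    by rewrite ltnNge.
  by rewrite e positionK.
have : s j != k by apply: contra ne => /eqP <-; rewrite perm_position.
rewrite -!val_eqE /= in ne * => ne'.
have := h (i, j); rewrite !inE ij /=; lia.
Qed.

(** * A permutation is determined by its descent letters and the numbers (31-2) *)

Lemma pat31_2_at_gap_bots s k :
  pat31_2_at s k = #|[set b in gap_bots s k | position s b < position s k]|.
Proof.
rewrite /pat31_2_at -(card_in_imset (f := fun p => s p.2)); last first.
  by apply: adjacent_inj2 => p; rewrite inE => /andP[].
apply: eq_card => b; rewrite inE; apply/imsetP/andP => [[p + ->]|].
  rewrite inE => /and3P[ap lp /andP[l1 l2]]; rewrite perm_position lp; split=> //.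
  by apply/gap_botsP; exists p; split=> //; rewrite l1 ltnW.
case=> /gap_botsP[[i j] /= [ij /andP[jk ki] e]]; rewrite -e perm_position => lt.
exists (i, j); rewrite // inE ij /= lt e jk ltn_neqAle ki andbT /=.
apply: contraTneq lt => /val_inj ->; rewrite perm_position -leqNgt.
by move: ij; rewrite /adjacent /=; lia.
Qed.

(** The gap of k is open.  So if a < k is on the right of k, then the gap of k
    is one more open gap on the left of a than the (31-2)_k on the left of k. *)
Lemma position_before s k a : a < k ->
  (position s a < position s k) =
  (#|[set b in gap_bots s k | position s b <= position s a]| <= pat31_2_at s k).
Proof.
move=> ak; rewrite pat31_2_at_gap_bots; case: ltnP => [lt|].
  apply/esym; apply: subset_leq_card; apply/subsetP=> b; rewrite !inE => /andP[-> h] /=.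
  exact: leq_ltn_trans h lt.
rewrite leq_eqVlt => /orP[/eqP/val_inj/position_inj e|lt]; first by rewrite e ltnn in ak.
apply/esym/negbTE; rewrite -ltnNge; apply: proper_card; apply/properP; split.
  apply/subsetP=> b; rewrite !inE => /andP[-> h] /=; lia.
have [||[i j] /= ij /and4P[ki ja sik sjk]] := @first_entry n (fun i => s i < k) _ _ lt.
- by rewrite positionK ltnn.
- by rewrite positionK.
exists (s j); rewrite inE ?perm_position ?ja ?andbT.
  by apply/gap_botsP; exists (i, j); rewrite sjk leqNgt sik.
by rewrite negb_and -leqNgt orbC; move: ij; rewrite /adjacent /=; lia.
Qed.

(** b is the first letter < k after k; phrased so as to depend only on the
    relative order of the letters <= k. *)
Definition next_lower s k b : bool := [&& b < k, position s k < position s b &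
  [forall c : 'I_n, (c < k) && (position s k < position s c)
     ==> (position s b <= position s c)]].

Lemma next_lower_desc_top s k b : k \in desc_tops s ->
  next_lower s k b = (position s b == (position s k).+1 :> nat).
Proof.
move=> /desc_topsP[[i j] /= [/eqP /= ij jk ek]].
have pk : position s k = i by rewrite -ek perm_position.
rewrite /next_lower pk; apply/and3P/eqP => [[bk ib /forallP h]|bi].
  have /implyP := h (s j); rewrite perm_position; lia.
have -> : b = s j by rewrite -(positionK s b); congr (s _); apply: val_inj; rewrite /= bi ij.
rewrite perm_position; split=> //; first by lia.
apply/forallP=> c; apply/implyP=> /andP[_]; lia.
Qed.

(** Inserting k splits an open gap, whose left part stays open if and only if k
    is a descent bottom, and whose right part closes if and only if k is a
    descent top. *)
Lemma gap_bots_succ s k b :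
  (b \in gap_bots s k.+1) = if b == k then k \in desc_bots s
    else (b \in gap_bots s k) && ~~ ((k \in desc_tops s) && next_lower s k b).
Proof.
have [->|bk] := eqVneq b k.
  by apply/gap_botsP/desc_botsP=> -[p [ap l e]]; exists p; split=> //; lia.
have {}bk : b != k :> nat by [].
apply/gap_botsP/andP => [[[i j] /= [ij l e]]|[/gap_botsP[[i j] /= [ij l e]] nh]].
  split; first by apply/gap_botsP; exists (i, j); split=> //=; lia.
  apply/negP=> /andP[kT]; rewrite next_lower_desc_top //.
  rewrite -e perm_position (eqP ij) eqSS /= => /eqP /val_inj ik.
  by move: l; rewrite ik positionK; lia.
exists (i, j); split=> //=; have : s i != k; last by rewrite -val_eqE /=; lia.
apply: contra nh => /eqP ik.
have kT : k \in desc_tops s by apply/desc_topsP; exists (i, j); split=> //=; rewrite e; lia.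
by rewrite kT next_lower_desc_top // -e -ik !perm_position (eqP ij) eqxx.
Qed.

(** Inserting the letters in increasing order, the relative order of the letters
    inserted so far and the open gaps among them are the same for s and s'. *)
Theorem descents_pat31_2_inj s s' :
  desc_tops s = desc_tops s' -> desc_bots s = desc_bots s' ->
  pat31_2_at s =1 pat31_2_at s' -> s = s'.
Proof.
move=> eT eB eP.
have main m : m <= n ->
   (forall b : 'I_n, (b \in gap_bots s m) = (b \in gap_bots s' m)) /\
   (forall a b : 'I_n, a < m -> b < m ->
     (position s a < position s b) = (position s' a < position s' b)).
  elim: m => [|m IH] mn.
    split=> // b; apply/gap_botsP/gap_botsP=> -[p []]; lia.
  have [IHg IHp] := IH (ltnW mn); pose k := Ordinal mn.
  (* reduces comparisons with k to those with k on the right *)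
  have swap u a b :
      a != b -> (position u a < position u b) = ~~ (position u b < position u a).
    move=> ab; have : position u a != position u b by rewrite (inj_eq (@position_inj u)).
    by rewrite -val_eqE /=; lia.
  have beforek a :
      a < m -> (position s a < position s k) = (position s' a < position s' k).
    move=> am; rewrite !position_before // eP.
    congr (_ <= _); apply: eq_card => b; rewrite !inE IHg.
    case: (boolP (b \in gap_bots s' k)) => //= /gap_botsP[p [_ /andP[bk _] _]].
    by rewrite leqNgt IHp // -leqNgt.
  have order a b : a < m.+1 -> b < m.+1 ->
     (position s a < position s b) = (position s' a < position s' b).
    have lower c : c != k -> c < m.+1 -> c < m by rewrite -val_eqE /=; lia.
    have [->|ak] := eqVneq a k; have [->|bk] := eqVneq b k => am bm.
    - by rewrite !ltnn.
    - by rewrite !(swap _ k b) 1?eq_sym // beforek //; apply: lower.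
    - by apply: beforek; apply: lower.
    - by apply: IHp; apply: lower.
  split=> // b; rewrite !(@gap_bots_succ _ k) eT eB; case: ifP => // /negbT bk.
  rewrite IHg; case: (boolP (b \in gap_bots s' k)) => //= /gap_botsP[p [_ /andP[ltbk _] _]].
  rewrite /next_lower ltbk order //=; last by lia.
  congr (~~ [&& _, _ & _]); apply: eq_forallb => c; case: (ltnP c k) => //= ck.
  by rewrite order ?(leqNgt (position _ b)) ?order //; lia.
have [_ order] := main n (leqnn n).
have pos u a : position u a = \sum_b (position u b < position u a : nat) :> nat.
  rewrite -(reindex_inj (@position_inj u) (P := xpredT) (F := fun j => j < position u a : nat)).
  by rewrite sum_ord_ltn // ltnW.
apply: invg_inj; apply/permP=> a; apply: val_inj.
have: position s a = position s' a :> nat.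
  by rewrite [LHS]pos [RHS]pos; apply: eq_bigr => b _; rewrite order.
by [].
Qed.

End Words.

(** * The maps Phi *)

Section Coding.
Variable n : nat.
Implicit Types (s t : 'S_n) (k l : 'I_n) (c : 'I_n -> nat).

(** [is_Phi] without the indexing of the tops by their rank: the inversion tables
    become counts over letters.  The condition on descent bottoms follows by
    complementation, see [coded_desc_bots]. *)
Definition coded c s t : Prop :=
  [/\ t @: ndesc_tops s = ndesc_bots s,
      forall k, k \in ndesc_tops s ->
        #|[set l in ndesc_tops s | (l < k) && (t k < t l)]| = c k &
      forall k, k \in desc_tops s ->
        #|[set l in desc_tops s | (k < l) && (t l < t k)]| = c k].

Lemma enum_val_reindex (A : {set 'I_n}) (P : pred 'I_n) :
  #|[set l in A | P l]| = #|[set a : 'I_#|A| | P (enum_val a)]|.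
Proof.
rewrite -[RHS](card_imset _ (@enum_val_inj _ (mem A))); apply: eq_card => l.
rewrite inE; apply/andP/imsetP => [[lA Pl]|[a + ->]].
  by exists (enum_rank_in lA l); rewrite ?inE enum_rankK_in.
by rewrite inE => Pa; rewrite enum_valP.
Qed.

Lemma is_Phi_coded c s t : is_Phi c s t -> coded c s t.
Proof.
case/existsP=> f /existsP[g /and5P[fA /forallP fc gA /forallP gc]].
case/andP=> /forallP tf /forallP tg.
have {}tf b : t (enum_val b) = f b by apply/eqP.
have {}tg b : t (enum_val b) = g b by apply/eqP.
split.
- have /andP[_ /eqP <-] := fA; apply/setP=> l; apply/imsetP/imsetP => [[k kA ->]|[b _ ->]].
    by exists (enum_rank_in kA k); rewrite // -tf enum_rankK_in.
  by exists (enum_val b); rewrite ?enum_valP.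
- move=> k kA; rewrite -(enum_rankK_in kA kA); set b := enum_rank_in kA k.
  rewrite -(eqP (fc b)) enum_val_reindex; apply: eq_card => a.
  by rewrite !inE enum_val_ltn !tf.
- move=> k kA; rewrite -(enum_rankK_in kA kA); set b := enum_rank_in kA k.
  rewrite -(eqP (gc b)) enum_val_reindex; apply: eq_card => a.
  by rewrite !inE enum_val_ltn !tg.
Qed.

Lemma imset_permC t (A B : {set 'I_n}) : t @: (~: A) = ~: B -> t @: A = B.
Proof.
move=> e; apply: setC_inj; rewrite -e; apply/setP=> x.
by rewrite inE -[x](permKV t) !(mem_imset _ _ (@perm_inj _ t)) inE.
Qed.

Variables (c : 'I_n -> nat) (s t : 'S_n).
Hypothesis st : coded c s t.
Hypothesis cP : forall k, c k <= #|down_jumps s k|.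

Lemma coded_desc_bots : t @: desc_tops s = desc_bots s.
Proof. by have [e _ _] := st; apply: imset_permC. Qed.

Lemma below_perm_tops k : \sum_l ((l \in desc_tops s) && (t l < k) : nat) =
   below (desc_tops s) k + #|down_jumps s k| + (k \in desc_tops s).
Proof. by rewrite -below_perm coded_desc_bots below_desc_bots. Qed.

Lemma below_perm_ntops k : \sum_l ((l \in ndesc_tops s) && (t l < k) : nat) +
   #|down_jumps s k| + (k \in desc_tops s) = below (ndesc_tops s) k.
Proof.
have [e _ _] := st; rewrite -below_perm e.
have := below_setC (desc_tops s) k; rewrite -(below_setC (desc_bots s) k).
rewrite below_desc_bots -/(ndesc_tops s) -/(ndesc_bots s).
lia.
Qed.

(** By decreasing induction on k: larger tops l satisfy t l >= l > k.  If
    t k < k, counting the values below k shows that the number of l < k in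
    [ndesc_tops s] with t l >= k is one more than the number of descents across
    k, which bounds c k; but all these l are counted by c k. *)
Lemma coded_ndesc_top_le k : k \in ndesc_tops s -> k <= t k.
Proof.
have [m] := ubnP (n - k); elim: m k => // m IH k km kN; rewrite leqNgt; apply/negP=> tk.
have [_ /(_ k kN) ck _] := st.
suff : #|down_jumps s k| < #|[set l in ndesc_tops s | (l < k) && (t k < t l)]|.
  by rewrite ck ltnNge cP.
have sub : #|[set l in ndesc_tops s | (l < k) && (k <= t l)]|
     <= #|[set l in ndesc_tops s | (l < k) && (t k < t l)]|.
  by apply: subset_leq_card; apply/subsetP=> l; rewrite !inE => /and3P[-> ->] /=; lia.
apply: leq_trans sub.
have := below_perm_ntops k; rewrite inE in kN; rewrite (negbTE kN) addn0 => e.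
have : #|[set l in ndesc_tops s | (l < k) && (k <= t l)]| +
  \sum_l ((l \in ndesc_tops s) && (t l < k) : nat) = below (ndesc_tops s) k + 1.
  rewrite below_sum -(sum_eq1 k) card_set_sum -!big_split /=; apply: eq_bigr => l _.
  have [->|lk] := eqVneq l k; first by rewrite inE kN tk ltnn.
  rewrite -val_eqE /= in lk.
  case: (boolP (l \in ndesc_tops s)) => //= lN.
  case: (ltnP l k) => kl; first by case: ltnP.
  have : l <= t l by apply: IH => //; have := ltn_ord l; lia.
  lia.
rewrite -e; lia.
Qed.

(** By increasing induction on k: smaller tops l satisfy t l < l < k.  If
    t k >= k, then among the l > k in [desc_tops s] those with t l < k number one
    more than the descents across k, and all of them are counted by c k. *)
Lemma coded_desc_top_gt k : k \in desc_tops s -> t k < k.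
Proof.
have [m] := ubnP (k : nat); elim: m k => // m IH k km kN; rewrite ltnNge; apply/negP=> tk.
have [_ _ /(_ k kN) ck] := st.
suff : #|down_jumps s k| < #|[set l in desc_tops s | (k < l) && (t l < t k)]|.
  by rewrite ck ltnNge cP.
have sub : #|[set l in desc_tops s | (k < l) && (t l < k)]|
     <= #|[set l in desc_tops s | (k < l) && (t l < t k)]|.
  by apply: subset_leq_card; apply/subsetP=> l; rewrite !inE => /and3P[-> ->] /=; lia.
apply: leq_trans sub.
have := below_perm_tops k; rewrite kN => e.
have : \sum_l ((l \in desc_tops s) && (t l < k) : nat) =
   below (desc_tops s) k + #|[set l in desc_tops s | (k < l) && (t l < k)]|.
  rewrite below_sum card_set_sum -!big_split /=; apply: eq_bigr => l _.
  have [->|lk] := eqVneq l k; first by rewrite kN ltnn ltnNge tk.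
  rewrite -val_eqE /= in lk.
  case: (boolP (l \in desc_tops s)) => //= lN.
  case: (ltnP k l) => kl; first by case: (ltnP l k) => //; lia.
  have : t l < l by apply: IH => //; lia.
  lia.
lia.
Qed.

Lemma coded_wexc : wexc t = ndesc_tops s.
Proof.
apply/setP=> k; rewrite [in LHS]inE; apply/idP/idP; last exact: coded_ndesc_top_le.
by apply: contraTT; rewrite inE negbK -ltnNge; apply: coded_desc_top_gt.
Qed.

(** In a nesting at k, both arcs rise weakly or both fall; hence only tops of
    the same kind as k are compared with k, as in the code. *)
Lemma coded_nest_at k : nest_at t k = c k.
Proof.
have [_ cN cT] := st; rewrite /nest_at; case: leqP => tk.
  have kN : k \in ndesc_tops s by rewrite -coded_wexc inE.
  by rewrite -cN // -coded_wexc; apply: eq_card => l; rewrite !inE; lia.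
have kT : k \in desc_tops s.
  by apply: contraTT tk => kN; rewrite -leqNgt coded_ndesc_top_le // inE.
have eT : desc_tops s = ~: wexc t by rewrite coded_wexc setCK.
by rewrite -cT // eT; apply: eq_card => l; rewrite !inE; lia.
Qed.

(** Up to a correction when k is a descent top, both sides are the excess of
    descent bottoms below k over descent tops below k: for t, this is the number
    of falling arcs over k. *)
Lemma coded_cros_nest_at k : cros_at t k + nest_at t k = #|down_jumps s k|.
Proof.
apply: (@addIn (k \notin wexc t)); rewrite cros_nest_at.
apply: (@addnI (below (desc_tops s) k)).
have -> : (k \notin wexc t) = (k \in desc_tops s) by rewrite coded_wexc inE negbK.
rewrite addnA -below_perm_tops arcs_over_sym below_sum card_set_sum -big_split /=.
apply: eq_bigr => l _; case: (boolP (l \in desc_tops s)) => lT /=.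
  by have := coded_desc_top_gt lT; lia.
have /coded_ndesc_top_le : l \in ndesc_tops s by rewrite inE.
lia.
Qed.

Lemma coded_cros_at k : cros_at t k = #|down_jumps s k| - c k.
Proof. by rewrite -coded_cros_nest_at coded_nest_at addnK. Qed.

Lemma des_desc_tops : #|desc_tops s| = des s.
Proof. by rewrite card_in_imset //; apply: adjacent_inj1 => p; rewrite inE => /andP[]. Qed.

Lemma coded_wex : wex t = ndes s.
Proof.
have -> : wex t = #|wexc t| by [].
rewrite coded_wexc /ndes; have := cardsC (desc_tops s); rewrite card_ord.
by rewrite des_desc_tops -/(ndesc_tops s) => e; lia.
Qed.

Lemma coded_depth : NDdif s = Posz (depth t).
Proof.
have [e _ _] := st; rewrite /NDdif -e big_imset /=; last by move=> ? ? _ _ /perm_inj.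
rewrite -GRing.sumrB -coded_wexc /depth (big_morph Posz PoszD (erefl _)).
rewrite big_mkcond [RHS]big_mkcond; apply: eq_bigr => k _; rewrite inE.
by case: leqP => kt; case: ltnP => kt'; lia.
Qed.

Lemma coded_nfix : nfix t =
  #|[set k | [&& k \in ndesc_tops s, k \in ndesc_bots s & #|down_jumps s k| == c k]]|.
Proof.
have [e _ _] := st; apply: eq_card => k; rewrite !inE fixed_cros_at coded_wexc e.
rewrite -coded_cros_nest_at coded_nest_at -{2}[c k]add0n eqn_add2r.
by rewrite !inE.
Qed.

End Coding.

Lemma des_le n (s : 'S_n) : des s <= n.
Proof. by rewrite -des_desc_tops -[leqRHS](card_ord n) max_card. Qed.

(** All that the maps encode can be read off from the image alone. *)
Lemma coded_inj n (c c' : 'I_n -> nat) (s s' t : 'S_n) :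
    (forall k, c k <= #|down_jumps s k|) -> (forall k, c' k <= #|down_jumps s' k|) ->
    coded c s t -> coded c' s' t ->
  [/\ desc_tops s = desc_tops s', desc_bots s = desc_bots s', c =1 c' &
      forall k, #|down_jumps s k| = #|down_jumps s' k|].
Proof.
move=> cP cP' st st'.
have eT : desc_tops s = desc_tops s'.
  by apply: setC_inj; rewrite -[LHS](coded_wexc st cP) -[RHS](coded_wexc st' cP').
split=> // [|k|k].
- by rewrite -(coded_desc_bots st) -(coded_desc_bots st') eT.
- by rewrite -(coded_nest_at st cP) -(coded_nest_at st' cP').
- by rewrite -(coded_cros_nest_at st cP) -(coded_cros_nest_at st' cP').
Qed.

Lemma Phi_C_coded n (s : 'S_n) : coded (pat31_2_at s) s (Phi_C s).
Proof. by apply: is_Phi_coded; apply: (xchooseP (Phi_C_exists s)). Qed.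

Lemma Phi_SZ_coded n (s : 'S_n) : coded (pat2_31_at s) s (Phi_SZ s).
Proof. by apply: is_Phi_coded; apply: (xchooseP (Phi_SZ_exists s)). Qed.

Lemma Phi_C_inj n : injective (@Phi_C n).
Proof.
move=> s s' e; have st := Phi_C_coded s; rewrite e in st.
have [eT eB eP _] := coded_inj (pat31_2_at_le s) (pat31_2_at_le s') st (Phi_C_coded s').
exact: descents_pat31_2_inj.
Qed.

Lemma Phi_SZ_inj n : injective (@Phi_SZ n).
Proof.
move=> s s' e; have st := Phi_SZ_coded s; rewrite e in st.
have [eT eB eP eJ] := coded_inj (pat2_31_at_le s) (pat2_31_at_le s') st (Phi_SZ_coded s').
apply: descents_pat31_2_inj => // k.
by apply: (@addIn (pat2_31_at s k)); rewrite -down_jumps_split eJ down_jumps_split eP.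
Qed.

Lemma Phi_C_stats n (s : 'S_n) :
  (ndes s, pmin s, pat31_2 s, pat2_31 s, MADL s, NDdif s) =
  (let t := Phi_C s in
   (wex t, nfix t, nest t, cros t, inversions t, Posz (depth t))).
Proof.
have st := Phi_C_coded s; have cP := pat31_2_at_le s; move: (Phi_C s) st => t st /=.
have en : nest t = pat31_2 s by rewrite nest_sum; apply: eq_bigr => k _; rewrite (coded_nest_at st cP).
have ec : cros t = pat2_31 s.
  by rewrite cros_sum; apply: eq_bigr => k _; rewrite (coded_cros_at st cP) down_jumps_split addKn.
have dt := depth_cros_nest t; rewrite (coded_wex st cP) en ec in dt.
rewrite inversions_depth_nest (coded_depth st cP) (coded_wex st cP) en ec.
have -> : pmin s = nfix t.
  rewrite (coded_nfix st cP); apply: eq_card => k; rewrite [in LHS]inE [in RHS]inE.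
  by rewrite rl_min_ndesc_top down_jumps_split -{2}[pat31_2_at s k]addn0 eqn_add2l andbCA.
by congr (_, _, _, _, _, _); rewrite /MADL dt /ndes; have := des_le s; lia.
Qed.

Lemma Phi_SZ_stats n (s : 'S_n) :
  (ndes s, fmax s, pat31_2 s, pat2_31 s, MAD s, NDdif s) =
  (let t := Phi_SZ s in
   (wex t, nfix t, cros t, nest t, inversions t, Posz (depth t))).
Proof.
have st := Phi_SZ_coded s; have cP := pat2_31_at_le s; move: (Phi_SZ s) st => t st /=.
have en : nest t = pat2_31 s by rewrite nest_sum; apply: eq_bigr => k _; rewrite (coded_nest_at st cP).
have ec : cros t = pat31_2 s.
  by rewrite cros_sum; apply: eq_bigr => k _; rewrite (coded_cros_at st cP) down_jumps_split addnK.
have dt := depth_cros_nest t; rewrite (coded_wex st cP) en ec in dt.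
rewrite inversions_depth_nest (coded_depth st cP) (coded_wex st cP) en ec.
have -> : fmax s = nfix t.
  rewrite (coded_nfix st cP); apply: eq_card => k; rewrite [in LHS]inE [in RHS]inE.
  by rewrite lr_max_ndesc_bot down_jumps_split -{2}[pat2_31_at s k]add0n eqn_add2r.
by congr (_, _, _, _, _, _); rewrite /MAD dt /ndes; have := des_le s; lia.
Qed.

Theorem theorem2p3 (n : nat) (hn : 1 <= n) :
  [/\ bijective (@Phi_C n),
      bijective (@Phi_SZ n),
      forall s : 'S_n,
        (ndes s, pmin s, pat31_2 s, pat2_31 s, MADL s, NDdif s) =
        (let t := Phi_C s in
         (wex t, nfix t, nest t, cros t, inversions t, Posz (depth t))),
      forall s : 'S_n,
        (ndes s, fmax s, pat31_2 s, pat2_31 s, MAD s, NDdif s) =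
        (let t := Phi_SZ s in
         (wex t, nfix t, cros t, nest t, inversions t, Posz (depth t))) &
      forall s : 'S_n,
        (wex s, nest s, cros s, depth s) =
        (let t := Phi_star s in
         (wex t, cros t, nest t, depth t))].
Proof.
split; [exact: injF_bij (@Phi_C_inj n) | exact: injF_bij (@Phi_SZ_inj n)
  | exact: Phi_C_stats | exact: Phi_SZ_stats |].
move=> s; have := Phi_C_stats (finv (@Phi_C n) s).
rewrite (f_finv (@Phi_C_inj n)) /Phi_star /=.
have := Phi_SZ_stats (finv (@Phi_C n) s) => /=.
by move=> [<- _ <- <- _ eSZ] [<- _ <- <- _]; rewrite eSZ => -[<-].
Qed.
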